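(* Let $S\subseteq\mathbb{R}^n$ be closed, $x\in S$ and $d\in\mathbb{R}^n$. Then $$\widehat T_S(x;d)=N_S(x;d)^\circ=N^c_S(x;d)^\circ,\qquad \widehat T_S(x;d)^\circ=N^c_S(x;d).$$ In particular, the directional regular tangent cone $\widehat T_S(x;d)$ is closed and convex.
   Context: For $x\in S$, the tangent (contingent) cone is $T_S(x):=\{d: \exists t_k\downarrow0,\ d_k\to d\text{ with }x+t_kd_k\in S\}$. For $x\in S$ and $d\in\mathbb{R}^n$, the regular (Clarke) tangent cone to $S$ at $x$ in direction $d$ is $\widehat T_S(x;d):=\{v:\ \forall t_k\downarrow0,\ d_k\to d\text{ with }x+t_kd_k\in S,\ \exists v_k\to v\text{ with }v_k\in T_S(x+t_kd_k)\}$. For $x\in S$, the regular (Fréchet) normal cone is $\widehat N_S(x):=\{v:\langle v,x'-x\rangle\le o(\|x'-x\|)\ \forall x'\in S\}$ (with $\widehat N_S(y)$ empty if $y\notin S$). The directional limiting normal cone is $N_S(x;d):=\{v:\exists t_k\downarrow0,\ d_k\to d,\ v_k\to v\text{ with }v_k\in\widehat N_S(x+t_kd_k)\}$; it is empty if $d\notin T_S(x)$. The directional Clarke normal cone is $N^c_S(x;d):=\mathrm{cl}\,\mathrm{co}\,N_S(x;d)$, the closure of the convex hull of $N_S(x;d)$. The polar of a set $C\subseteq\mathbb{R}^n$ is $C^\circ:=\{v:\langle v,w\rangle\le0\ \forall w\in C\}$.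
   Formalization: The equality of the polar of the regular tangent cone with N^c_S(x;d) is stated only for d in T_S(x); for other d the set N_S(x;d) is empty, so N^c_S(x;d) is empty while the polar is {0}, and the equality fails. *)

(* Defs.v *)
From mathcomp Require Export all_boot all_order all_algebra.
From mathcomp Require Export all_classical all_reals all_analysis.
Export numFieldNormedType.Exports.

Set Implicit Arguments.
Unset Strict Implicit.
Unset Printing Implicit Defensive.

Import Order.TTheory GRing.Theory Num.Theory.

Local Open Scope classical_set_scope.
Local Open Scope ring_scope.

Section DirectionalCones.
Context {R : realType} {n : nat}.
Implicit Types (S C : set 'rV[R]_n) (x d v w : 'rV[R]_n).

Definition dot v w : R := \sum_i v 0 i * w 0 i.

(* The library norm on 'rV[R]_n is the sup norm; it induces the same topology,
   so convergence, [closed] and [closure] below are the library's. *)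
Definition enorm v : R := Num.sqrt (dot v v).

(* t_k -> 0 through positive values; monotonicity is not required. *)
Definition decr_to0 (t : nat -> R) : Prop :=
  (forall k, 0 < t k) /\ t k @[k --> \oo] --> (0 : R).

Definition polar C : set 'rV[R]_n :=
  [set v | forall w, C w -> dot v w <= 0].

Definition tangent_cone S x : set 'rV[R]_n :=
  [set d | exists (t : nat -> R) (d_ : nat -> 'rV[R]_n),
     [/\ decr_to0 t, d_ k @[k --> \oo] --> d
       & forall k, S (x + t k *: d_ k)]].

Definition dir_regular_tangent_cone S x d : set 'rV[R]_n :=
  [set v | forall (t : nat -> R) (d_ : nat -> 'rV[R]_n),
     decr_to0 t -> d_ k @[k --> \oo] --> d ->
     (forall k, S (x + t k *: d_ k)) ->
     exists v_ : nat -> 'rV[R]_n,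
       v_ k @[k --> \oo] --> v /\
       forall k, tangent_cone S (x + t k *: d_ k) (v_ k)].

(* The little-o inequality is one-sided: <v, y - x> may be very negative.
   The cone is empty when x is not in S. *)
Definition regular_normal_cone S x : set 'rV[R]_n :=
  [set v | S x /\
     forall eps : R, 0 < eps ->
       \forall y \near within S (nbhs x),
         dot v (y - x) <= eps * enorm (y - x)].

Definition dir_normal_cone S x d : set 'rV[R]_n :=
  [set v | exists (t : nat -> R) (d_ v_ : nat -> 'rV[R]_n),
     [/\ decr_to0 t, d_ k @[k --> \oo] --> d, v_ k @[k --> \oo] --> v
       & forall k, regular_normal_cone S (x + t k *: d_ k) (v_ k)]].

(* The convex hull of the empty set is empty. *)
Definition convex_hull C : set 'rV[R]_n :=
  smallest (@convex_set R 'rV[R]_n) C.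

Definition dir_clarke_normal_cone S x d : set 'rV[R]_n :=
  closure (convex_hull (dir_normal_cone S x d)).

End DirectionalCones.

(* Main.v *)
Require Import Defs.
From mathcomp Require Import all_boot all_order all_algebra.
From mathcomp Require Import all_classical all_reals all_analysis.
From mathcomp Require Import ring lra.

(** Everything follows from the first equality, that the directional regular
    tangent cone T is the polar of the directional normal cone N.  A polar is
    closed and convex, and it does not change when N is replaced by its closed
    convex hull.  The polar of T is then the bipolar of that hull; the hull is a
    closed convex cone, and it contains 0 as soon as d is tangent (0 is a
    regular normal at every point of S), so [bipolar] gives it back.

    For the first equality, T is contained in the polar of N because a regular
    normal makes a nonpositive product with every tangent at the same point
    ([regular_normal_tangent]), and this passes to the limit.  The converse is
    the substantial part.  It suffices to show that, for v in the polar of N,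
    the distance from v to the tangent cone at p = x + t d' tends to 0 when
    p stays in S, t tends to 0 and d' tends to d
    ([tangent_uniform_of_polar_normal]).
    If v stays at a distance more than e from the tangent cone at p, then the
    points p + h v, for small h, are at a distance more than e h from S.  A ball
    that slides along this segment, growing at the rate e / 2, contains p at the
    start and is off S at the end.  At the last time at which it meets S it only
    touches S, at a point y, so the vector w from y to the centre is normal to
    S; as the ball leaves S for good while it is growing, the normalized w has a
    product at least e / 2 with v ([sliding_ball]).  Moreover y is as
    close to p as desired, in particular when compared with t, so y is also
    reached from x in a direction close to d.  A cluster point of these unit
    normals belongs to N and has a positive product with v, which contradicts
    the choice of v. *)

Set Implicit Arguments.
Unset Strict Implicit.
Unset Printing Implicit Defensive.

Import Order.TTheory GRing.Theory Num.Theory.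

Local Open Scope classical_set_scope.
Local Open Scope ring_scope.

(** * The Euclidean inner product and its topology *)

Section InnerProduct.
Context {R : realType} {n : nat}.
Implicit Types (a b c v w : 'rV[R]_n) (k : R).

Lemma dotC a b : dot a b = dot b a.
Proof. by apply: eq_bigr => i _; rewrite mulrC. Qed.

Lemma dotDl a b c : dot (a + b) c = dot a c + dot b c.
Proof. by rewrite -big_split; apply: eq_bigr => i _; rewrite mxE mulrDl. Qed.

Lemma dotZl k a b : dot (k *: a) b = k * dot a b.
Proof. by rewrite mulr_sumr; apply: eq_bigr => i _; rewrite mxE mulrA. Qed.

Lemma dotDr a b c : dot a (b + c) = dot a b + dot a c.
Proof. by rewrite dotC dotDl !(dotC a). Qed.

Lemma dotZr k a b : dot a (k *: b) = k * dot a b.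
Proof. by rewrite dotC dotZl (dotC a). Qed.

Lemma dotNl a b : dot (- a) b = - dot a b.
Proof. by rewrite -scaleN1r dotZl mulN1r. Qed.

Lemma dotNr a b : dot a (- b) = - dot a b.
Proof. by rewrite dotC dotNl (dotC a). Qed.

Lemma dot0l a : dot 0 a = 0.
Proof. by rewrite -(scale0r a) dotZl mul0r. Qed.

Lemma dot_ge0 a : 0 <= dot a a.
Proof. by apply: sumr_ge0 => i _; rewrite -expr2 sqr_ge0. Qed.

Lemma sqr_enorm a : enorm a ^+ 2 = dot a a.
Proof. by rewrite sqr_sqrtr // dot_ge0. Qed.

Lemma enorm_ge0 a : 0 <= enorm a.
Proof. exact: sqrtr_ge0. Qed.

Lemma enormZ k a : 0 <= k -> enorm (k *: a) = k * enorm a.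
Proof.
move=> k0; rewrite /enorm dotZl dotZr mulrA -expr2 sqrtrM ?sqr_ge0 //.
by rewrite sqrtr_sqr ger0_norm.
Qed.

Lemma dot_subsub a b : dot (a - b) (a - b) = dot a a - 2 * dot a b + dot b b.
Proof. rewrite !(dotDl, dotDr, dotNl, dotNr) (dotC b a); ring. Qed.

(** The topology comes from the sup norm, whereas projections are Euclidean; the
    comparison is needed in this direction only, to bound Euclidean balls. *)
Lemma norm_le_enorm a : `|a| <= enorm a.
Proof.
rewrite [leLHS]/Num.norm /= mx_normrE; apply/bigmax_leP; split.
  exact: enorm_ge0.
move=> [i j] _ /=; rewrite (ord1 i) -sqrtr_sqr ler_sqrt ?dot_ge0 //.
rewrite /dot (bigD1 j) //= -expr2 lerDl.
by apply: sumr_ge0 => l _; rewrite -expr2 sqr_ge0.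
Qed.

Lemma norm_le_of_dot a k : 0 <= k -> dot a a <= k ^+ 2 -> `|a| <= k.
Proof.
move=> k0 ak; apply: le_trans (norm_le_enorm a) _.
by rewrite -(ger0_norm k0) -sqrtr_sqr ler_sqrt // sqr_ge0.
Qed.

Lemma cvg_dot T (F : set_system T) {FF : Filter F} (f g : T -> 'rV[R]_n) a b :
  f t @[t --> F] --> a -> g t @[t --> F] --> b ->
  dot (f t) (g t) @[t --> F] --> dot a b.
Proof.
move=> fa gb.
have cvg_coord (h : T -> 'rV[R]_n) c i : h t @[t --> F] --> c ->
    (h t 0 i : R) @[t --> F] --> (c 0 i : R).
  move=> hc.
  apply: (@cvg_comp _ _ _ h (fun M : 'rV[R]_n => M 0 i : R) _ _ _ hc).
  exact: coord_continuous.
apply: cvg_big => [|i _]; first exact: add_continuous.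
by apply: cvgM; exact: cvg_coord.
Qed.

Lemma cvg_enorm T (F : set_system T) {FF : Filter F} (f : T -> 'rV[R]_n) a :
  f t @[t --> F] --> a -> enorm (f t) @[t --> F] --> enorm a.
Proof.
move=> fa; have ff : dot (f t) (f t) @[t --> F] --> dot a a by exact: cvg_dot.
exact: cvg_comp ff (@sqrt_continuous R _).
Qed.

Lemma closed_dot_le v k : closed [set w | dot w v <= k].
Proof.
apply: (@preimage_closed _ _ (fun w => dot w v : R) [set y | y <= k]).
  move=> w _; apply: (@cvg_dot _ (nbhs w) _ id (cst v)) => //.
  exact: cvg_cst.
exact: closed_le.
Qed.

Lemma closed_dot_ge v k : closed [set w | k <= dot w v].
Proof.
apply: (@preimage_closed _ _ (fun w => dot w v : R) [set y | k <= y]).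
  move=> w _; apply: (@cvg_dot _ (nbhs w) _ id (cst v)) => //.
  exact: cvg_cst.
exact: closed_ge.
Qed.

Lemma closed_norm_le a k : closed [set w | `|w - a| <= k].
Proof.
apply: (@preimage_closed _ _ (fun w => `|w - a|) [set y : R | y <= k]).
  move=> w _; apply: (@cvg_norm _ _ _ (nbhs w)).
  exact: (cvgB (@cvg_id _ _) (cvg_cst _)).
exact: closed_le.
Qed.

Lemma compact_norm_le a k (C : set 'rV[R]_n) :
  closed C -> compact (C `&` [set w | `|w - a| <= k]).
Proof.
move=> cC; apply: bounded_closed_compact; last first.
  by apply: closedI => //; exact: closed_norm_le.
exists (`|a| + k); split; first exact: num_real.
move=> M Mk w [_ /= wk]; rewrite /= -(subrK a w).
apply: le_trans (ler_normD _ _) _; lra.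
Qed.

End InnerProduct.

(** * Limits and compactness *)

Section Limits.
Context {R : realType}.

(** The form in which first-order conditions are extracted from expansions of
    squared distances along a segment. *)
Lemma quadratic_ge0_at_zero (a b c h0 : R) : 0 < h0 ->
  (forall h, 0 < h <= h0 -> 0 <= a + b * h + c * h ^+ 2) -> 0 <= a.
Proof.
move=> h0p H.
have cvg_a : (a + b * h + c * h ^+ 2) @[h --> 0^'+] --> a + b * 0 + c * 0 ^+ 2.
  apply: cvg_at_right_filter; apply: cvgD.
    apply: cvgD; first exact: cvg_cst.
    by apply: cvgM; [exact: cvg_cst|exact: cvg_id].
  by apply: cvgM; [exact: cvg_cst|exact: exprn_continuous].
have -> : a = a + b * 0 + c * 0 ^+ 2 by ring.
apply: (closed_cvg (fun r : R => 0 <= r)) cvg_a; first exact: closed_ge.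
near=> h; apply: H; apply/andP; split; near: h.
  exact: nbhs_right_gt.
exact: nbhs_right_le.
Unshelve. all: end_near. Qed.

Lemma cvg_of_natSinv (V : normedModType R) (u : nat -> V) (a : V) :
  (forall k, `|u k - a| < k.+1%:R^-1) -> u k @[k --> \oo] --> a.
Proof.
move=> ua; apply/cvgrPdist_lt => e e0; near=> k.
rewrite distrC; apply: lt_trans (ua k) _; near: k.
exact: (near_infty_natSinv_lt (PosNum e0)).
Unshelve. all: end_near. Qed.

(** Bolzano-Weierstrass for a family of sets that shrinks with the parameter:
    a cluster point of a selection from these sets is approximated inside every
    one of them, which avoids extracting a subsequence. *)
Lemma compact_approx (V : normedModType R) (K : set V) (A : R -> set V) :
  compact K ->
  (forall r s w, r <= s -> A r w -> A s w) ->
  (forall r, 0 < r -> exists w, K w /\ A r w) ->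
  exists w, K w /\ forall r, 0 < r -> exists w', A r w' /\ `|w' - w| < r.
Proof.
move=> cK Amono AK.
have /choice[u uP] : forall k : nat, exists w, K w /\ A k.+1%:R^-1 w.
  by move=> k; apply: AK.
have [w [Kw cw]] : K `&` cluster (u k @[k --> \oo]) !=set0.
  by apply: cK; exists 0 => // k _; have [] := uP k.
exists w; split=> // r r0.
have uA : (u k @[k --> \oo]) (A r).
  have [N _ HN] := near_infty_natSinv_lt (PosNum r0).
  exists N => // k Nk /=; have [_] := uP k; apply: Amono.
  exact/ltW/HN.
have [w' [Aw' bw']] := cw _ _ uA (nbhsx_ballx w r r0).
exists w'; split=> //; move: bw'; rewrite -ball_normE /= distrC //.
Qed.

End Limits.

(** * Tangents and normals obtained by approximation *)

Section ConesFromApproximation.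
Context {R : realType} {n : nat}.
Implicit Types (S : set 'rV[R]_n) (x d v w : 'rV[R]_n).

Lemma tangent_cone_approx S x v :
  (forall r : R, 0 < r -> exists t v',
     [/\ 0 < t < r, `|v' - v| < r & S (x + t *: v')]) ->
  tangent_cone S x v.
Proof.
move=> H.
have /choice[f fP] : forall k : nat, exists p : R * 'rV[R]_n,
    [/\ 0 < p.1 < k.+1%:R^-1, `|p.2 - v| < k.+1%:R^-1 & S (x + p.1 *: p.2)].
  move=> k; have [|t [v' tP]] := H k.+1%:R^-1; first by rewrite invr_gt0.
  by exists (t, v').
exists (fst \o f), (snd \o f); split=> [|| k]; last by have [] := fP k.
- split=> [k|]; first by have [/andP[]] := fP k.
  apply: (@cvg_of_natSinv _ R^o) => k; have [/andP[t0 tk] _ _] := fP k.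
  by rewrite subr0 gtr0_norm.
- by apply: cvg_of_natSinv => k; have [] := fP k.
Qed.

Lemma dir_normal_cone_approx S x d w :
  (forall r : R, 0 < r -> exists t d' w',
     [/\ 0 < t < r, `|d' - d| < r, `|w' - w| < r
       & regular_normal_cone S (x + t *: d') w']) ->
  dir_normal_cone S x d w.
Proof.
move=> H.
have /choice[f fP] : forall k : nat, exists p : R * 'rV[R]_n * 'rV[R]_n,
    [/\ 0 < p.1.1 < k.+1%:R^-1, `|p.1.2 - d| < k.+1%:R^-1,
        `|p.2 - w| < k.+1%:R^-1
      & regular_normal_cone S (x + p.1.1 *: p.1.2) p.2].
  move=> k; have [|t [d' [w' tP]]] := H k.+1%:R^-1; first by rewrite invr_gt0.
  by exists (t, d', w').
exists (fst \o fst \o f), (snd \o fst \o f), (snd \o f).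
split=> [|||k]; last by have [] := fP k.
- split=> [k|]; first by have [/andP[]] := fP k.
  apply: (@cvg_of_natSinv _ R^o) => k; have [/andP[t0 tk] _ _ _] := fP k.
  by rewrite subr0 gtr0_norm.
- by apply: cvg_of_natSinv => k; have [] := fP k.
- by apply: cvg_of_natSinv => k; have [] := fP k.
Qed.

Lemma tangent_cone0 S x : S x -> tangent_cone S x 0.
Proof.
move=> Sx; apply: tangent_cone_approx => r r0; exists (r / 2), 0.
by split; [lra|rewrite subrr normr0|rewrite scaler0 addr0].
Qed.

(** If S comes within e t of the segment of direction v at arbitrarily small
    times t, the directions of these points of S stay in a compact ball around
    v, and any of their cluster points is tangent.  It is used through its
    contrapositive: away from the tangent cone, S leaves a whole cone free. *)
Lemma tangent_cone_near S p v (e : R) :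
  (forall r : R, 0 < r -> exists t z,
     [/\ 0 < t < r, S z & `|p + t *: v - z| <= e * t]) ->
  exists u, tangent_cone S p u /\ `|u - v| <= e.
Proof.
move=> H.
pose A r u := exists t : R, 0 < t < r /\ S (p + t *: u).
have cK := @compact_norm_le _ _ v e setT closedT.
have [|r r0|u [[_ uv] Au]] := @compact_approx _ _ _ A cK.
- move=> r s u rs [t [/andP[t0 tr] Su]]; exists t; split=> //.
  by rewrite t0 (lt_le_trans tr).
- have [t [z [/andP[t0 tr] Sz ztv]]] := H r r0.
  exists (t^-1 *: (z - p)); split; last first.
    exists t; rewrite t0 tr scalerA divff ?gt_eqF // scale1r; split=> //.
    by rewrite addrC subrK.
  split=> //=; rewrite -(@ler_pM2r _ t) // mulrC.
  rewrite -{1}(ger0_norm (ltW t0)) -normrZ.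
  rewrite scalerBr scalerA divff ?gt_eqF // scale1r.
  by rewrite -addrA -opprD distrC.
exists u; split=> //; apply: tangent_cone_approx => r r0.
have [u' [[t [tr Su']] u'u]] := Au r r0.
by exists t, u'.
Qed.

(** If y is a projection of c on S, expanding the square of c - z around y gives
    2 <c - y, z - y> <= |z - y|^2 on S, which is o(|z - y|). *)
Lemma regular_normal_proximal S c y (k : R) : S y -> 0 <= k ->
  (forall z, S z -> dot (c - y) (c - y) <= dot (c - z) (c - z)) ->
  regular_normal_cone S y (k *: (c - y)).
Proof.
move=> Sy k0 ymin; split=> // eps eps0.
(* the bound is k |z - y|^2 / 2, so k |z - y| < eps is more than enough *)
have small : k * enorm (z - y) @[z --> y] --> k * enorm (y - y).
  apply: (@cvgM _ _ (nbhs y)); first exact: cvg_cst.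
  apply: (@cvg_enorm _ _ _ (nbhs y)).
  exact: (cvgB (@cvg_id _ _) (cvg_cst _)).
have : \forall z \near y, k * enorm (z - y) < eps.
  apply: (cvgr_lt _ small).
  by rewrite subrr /enorm dot0l sqrtr0 mulr0.
apply: filterS => z kz Sz.
have := ymin z Sz.
have -> : c - z = (c - y) - (z - y) by rewrite opprB addrA subrK.
rewrite (dot_subsub (c - y)) -(sqr_enorm (z - y)) dotZl => H.
have N0 := enorm_ge0 (z - y).
have {}H : 2 * dot (c - y) (z - y) <= enorm (z - y) ^+ 2 by lra.
nra.
Qed.

(** The key lemma.  The ball of centre p + s v and radius e s + rho contains p
    at s = 0 and is off S at s = t.  At the last time at which it meets S, its
    interior is off S, hence a contact point y is a projection of the centre and
    the radius vector w at y is a regular normal.  Since S stays outside at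
    later times, the distance from y to the centre then grows at least as fast
    as the radius: its derivative <w, v> is at least the rate e. *)
Lemma sliding_ball S p v (t e : R) : closed S -> S p -> 0 < t -> 0 < e ->
  (forall z, S z -> (2 * e * t) ^+ 2
                    < dot (p + t *: v - z) (p + t *: v - z)) ->
  exists y w, [/\ regular_normal_cone S y w, `|w| <= 1, e <= dot w v
    & `|y - p| <= t * (2 * e + `|v|)].
Proof.
move=> cS Sp t0 e0 far.
(* any rho with 0 < rho < e * t would do: the final radius has to be less than
   2 * e * t, and a positive radius makes the normal nonzero *)
pose rho := e * t / 2.
have rho0 : 0 < rho by rewrite /rho; nra.
pose gap (q : R * 'rV[R]_n) : R :=
  dot (p + q.1 *: v - q.2) (p + q.1 *: v - q.2) - (e * q.1 + rho) ^+ 2.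
have gap_cont : continuous gap.
  move=> q.
  have c1 : (fst : R * 'rV[R]_n -> R) q' @[q' --> q] --> q.1 by exact: cvg_fst.
  have c2 : (snd : R * 'rV[R]_n -> 'rV[R]_n) q' @[q' --> q] --> q.2.
    exact: cvg_snd.
  have cv : p + q'.1 *: v - q'.2 @[q' --> q] --> p + q.1 *: v - q.2.
    apply: cvgB c2; apply: cvgD; first exact: cvg_cst.
    by apply: cvgZ; [exact: c1|exact: cvg_cst].
  apply: cvgB; first exact: cvg_dot.
  have ce : e * q'.1 + rho @[q' --> q] --> e * q.1 + rho.
    by apply: cvgD; [apply: cvgM; [exact: cvg_cst|exact: c1]|exact: cvg_cst].
  exact: (@cvg_comp _ _ _ _ (fun r : R => r ^+ 2) _ _ _ ce
            (@exprn_continuous _ 2 _)).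
pose M := t * (2 * e + `|v|).
pose K : set (R * 'rV[R]_n) :=
  (`[0, t] `*` (S `&` [set y | `|y - p| <= M]))
  `&` (gap @^-1` [set r | r <= 0]).
have cK : compact K.
  have cX : compact (`[0, t]%classic `*` (S `&` [set y | `|y - p| <= M])).
    by apply: compact_setX; [exact: segment_compact|exact: compact_norm_le].
  apply: (subclosed_compact _ cX); last by move=> q [].
  apply: closedI; first by apply: (compact_closed _ cX); exact: norm_hausdorff.
  by apply: preimage_closed; [move=> q _; exact: gap_cont|exact: closed_le].
have KE s y : 0 <= s <= t -> S y ->
    dot (p + s *: v - y) (p + s *: v - y) <= (e * s + rho) ^+ 2 -> K (s, y).
  move=> /andP[s0 st] Sy near_y; split; last by rewrite /= /gap /= subr_le0.
  split; first by rewrite /= in_itv /= s0.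
  split=> //=; have -> : y - p = s *: v - (p + s *: v - y).
    by rewrite opprB addrCA opprD (addrC (- p)) addNKr.
  have r0 : 0 <= e * s + rho by nra.
  have := norm_le_of_dot r0 near_y.
  have := ler_normB (s *: v) (p + s *: v - y).
  rewrite normrZ (ger0_norm s0) /M => H1 H2.
  apply: le_trans H1 _; have v0 := normr_ge0 v.
  have := ler_wpM2r v0 st; rewrite /rho in H2; nra.
have K0 : K !=set0.
  exists (0, p); apply: KE => //; first by rewrite lexx ltW.
  by rewrite scale0r addr0 subrr dot0l sqr_ge0.
have [[s y]] : exists2 q, q \in K & forall q', q' \in K -> q'.1 <= q.1.
  apply: compact_EVT_max => //; apply: continuous_subspaceT => q.
  exact: cvg_fst.
rewrite inE => -[[/= + [Sy yp]] gap0] smax.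
rewrite in_itv /= => /andP[s0 st].
rewrite /gap /= subr_le0 in gap0.
set q := p + s *: v - y in gap0.
pose rad := e * s + rho.
have rad0 : 0 < rad by rewrite /rad; nra.
have s_lt_t : s < t.
  rewrite lt_neqAle st andbT; apply/eqP => sE.
  have := far y Sy; move: gap0; rewrite /q sE /rho; nra.
have beyond z h : S z -> 0 < h <= t - s ->
    (rad + e * h) ^+ 2
    < dot (p + (s + h) *: v - z) (p + (s + h) *: v - z).
  move=> Sz /andP[h0 ht]; rewrite ltNge; apply/negP => bad.
  suff : (s + h, z) \in K by move=> /smax /=; lra.
  rewrite inE; apply: KE => //; first by apply/andP; split; lra.
  by apply: le_trans bad _; rewrite /rad; lra.
have expand z h : dot (p + (s + h) *: v - z) (p + (s + h) *: v - z)
    = dot (p + s *: v - z) (p + s *: v - z)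
      + 2 * dot (p + s *: v - z) v * h + dot v v * h ^+ 2.
  have -> : p + (s + h) *: v - z = (p + s *: v - z) + h *: v.
    by rewrite scalerDl addrA -!addrA (addrC (h *: v)).
  move: (p + s *: v - z) => a.
  by rewrite !(dotDl, dotDr, dotZl, dotZr) (dotC v a); ring.
have ts0 : 0 < t - s by rewrite subr_gt0.
have outside z : S z -> rad ^+ 2 <= dot (p + s *: v - z) (p + s *: v - z).
  move=> Sz; rewrite -subr_ge0.
  apply: (@quadratic_ge0_at_zero _ _
    (2 * dot (p + s *: v - z) v - 2 * rad * e)
    (dot v v - e ^+ 2) _ ts0) => h hh.
  have := beyond z h Sz hh; rewrite expand; lra.
have qq : dot q q = rad ^+ 2 by apply/eqP; rewrite eq_le gap0 outside.
have qv : rad * e <= dot q v.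
  have : 0 <= 2 * dot q v - 2 * rad * e.
    apply: (@quadratic_ge0_at_zero _ _ (dot v v - e ^+ 2) 0 _ ts0) => h hh.
    have := beyond y h Sy hh; rewrite expand -/q qq.
    have /andP[h0 _] := hh; move=> H.
    rewrite -(pmulr_rge0 _ h0); lra.
  lra.
exists y, (rad^-1 *: q); split=> //.
- apply: regular_normal_proximal => //; first by rewrite invr_ge0 ltW.
  by move=> z Sz; rewrite -/q qq outside.
- apply: norm_le_of_dot => //; rewrite dotZl dotZr qq.
  by rewrite expr2 mulKf ?gt_eqF // mulVf ?gt_eqF // expr1n.
- by rewrite dotZl -(ler_pM2l rad0) mulrA divff ?gt_eqF // mul1r.
Qed.

End ConesFromApproximation.

(** * Polars, closed convex hulls and the bipolar theorem *)

Section ConvexDuality.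
Context {R : realType} {n : nat}.
Implicit Types (C A : set 'rV[R]_n) (v w : 'rV[R]_n).

Lemma convex_setP C : @convex_set R 'rV[R]_n C <->
  forall v w (k : R), 0 <= k <= 1 -> C v -> C w -> C (k *: v + (1 - k) *: w).
Proof.
split=> [cC v w k /andP[k0 k1] Cv Cw | cC v w k].
  by have := cC v w (Itv01 k0 k1); rewrite !inE; apply.
by rewrite !inE => Cv Cw; apply: cC => //; apply/andP.
Qed.

Lemma polarE C : polar C = \bigcap_(w in C) [set v | dot v w <= 0].
Proof. by []. Qed.

Lemma closed_polar C : closed (polar C).
Proof. by rewrite polarE; apply: closed_bigI => w _; exact: closed_dot_le. Qed.

Lemma convex_polar C : @convex_set R 'rV[R]_n (polar C).
Proof.
apply/convex_setP => v w k /andP[k0 k1] Pv Pw u Cu.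
have := Pv u Cu; have := Pw u Cu; rewrite dotDl !dotZl; nra.
Qed.

Lemma convex_convex_hull C : @convex_set R 'rV[R]_n (convex_hull C).
Proof.
apply/convex_setP => v w k k01 Hv Hw A [cA CA].
by apply: (convex_setP A).1 => //; [exact: Hv|exact: Hw].
Qed.

Lemma convex_closure C :
  @convex_set R 'rV[R]_n C -> @convex_set R 'rV[R]_n (closure C).
Proof.
move=> /convex_setP cC; apply/convex_setP => v w k k01 Cv Cw B.
set u := k *: v + _ => nB.
have cont : k *: q.1 + (1 - k) *: q.2 @[q --> (v, w)] --> u.
  by apply: cvgD; apply: cvgZ; [exact: cvg_cst|exact: cvg_fst|exact: cvg_cst|
     exact: cvg_snd].
have [[U V] /= [nU nV] UVB] := cont B nB.
have [v' [Cv' Uv']] := Cv U nU; have [w' [Cw' Vw']] := Cw V nV.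
exists (k *: v' + (1 - k) *: w'); split; first exact: cC.
exact: (UVB (v', w')).
Qed.

(** A property of C passes to its closed convex hull when it defines a closed
    convex set; polarity and stability under scaling are transferred so. *)
Lemma closed_convex_hull_min C A : closed A -> @convex_set R 'rV[R]_n A ->
  C `<=` A -> closure (convex_hull C) `<=` A.
Proof.
move=> clA cA CA; rewrite [X in _ `<=` X]((closure_id A).1 clA).
by apply: closureS; apply: smallest_sub.
Qed.

Lemma sub_closed_convex_hull C : C `<=` closure (convex_hull C).
Proof. apply: subset_trans (@subset_closure _ _); exact: sub_gen_smallest. Qed.

Lemma polar_closed_convex_hull C : polar (closure (convex_hull C)) = polar C.
Proof.
apply/seteqP; split=> v Pv w Cw; first exact/Pv/sub_closed_convex_hull.
have /(_ w Cw) : closure (convex_hull C) `<=` polar [set v].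
  apply: closed_convex_hull_min; [exact: closed_polar|exact: convex_polar|].
  by move=> u Cu _ ->; rewrite dotC; exact: Pv.
by move=> /(_ v erefl); rewrite dotC.
Qed.

Lemma closed_convex_hull_cone C :
  (forall k w, 0 <= k -> C w -> C (k *: w)) ->
  forall k w, 0 <= k -> closure (convex_hull C) w ->
    closure (convex_hull C) (k *: w).
Proof.
move=> coneC k w k0 Cw.
suff /(_ w Cw) : closure (convex_hull C) `<=`
    ( *:%R k) @^-1` closure (convex_hull C) by [].
apply: closed_convex_hull_min => [||u Cu].
- apply: preimage_closed; last exact: closed_closure.
  by move=> u _; exact: scaler_continuous.
- apply/convex_setP => u u' l l01 Hu Hu'.
  rewrite /preimage /= scalerDr !scalerA ![k * _]mulrC -!scalerA.
  have /convex_setP := convex_closure (@convex_convex_hull C); exact.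
- by apply: sub_closed_convex_hull; exact: coneC.
Qed.

(** The points of C in a large ball around w form a compact set; the radius is
    the Euclidean distance from w to a point c0 of C, so that the points outside
    are farther from w than c0. *)
Lemma nearest_point C w : closed C -> C !=set0 ->
  exists2 p, C p & forall c, C c -> dot (w - p) (w - p) <= dot (w - c) (w - c).
Proof.
move=> clC [c0 Cc0].
pose f (y : 'rV[R]_n) : R := dot (w - y) (w - y).
have cK := @compact_norm_le _ _ w (enorm (w - c0)) C clC.
have [||p] := @EVT_min_rV _ _ f _ _ cK.
- by exists c0; split=> //=; rewrite distrC norm_le_enorm.
- apply: continuous_subspaceT => y.
  by apply: (@cvg_dot _ _ _ (nbhs y)); apply: (cvgB (cvg_cst _) (@cvg_id _ _)).
rewrite inE => -[Cp /= pw] pmin; exists p => // c Cc.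
have [cw|cw] := leP `|c - w| (enorm (w - c0)).
  by apply: pmin; rewrite inE.
apply: (@le_trans _ _ (f c0)).
  by apply: pmin; rewrite inE; split=> //=; rewrite distrC norm_le_enorm.
rewrite /f -!sqr_enorm lerXn2r ?nnegrE ?enorm_ge0 //.
by apply: le_trans (ltW cw) _; rewrite distrC norm_le_enorm.
Qed.

(** Let p be the projection on C of a point w of the bipolar.  By convexity
    <w - p, c - p> <= 0 on C; as C is a cone, c = 0 and c = 2 p give
    <w - p, p> = 0, so w - p is in the polar of C.  Then
    |w - p|^2 = <w - p, w> <= 0 and w = p. *)
Lemma bipolar C : closed C -> @convex_set R 'rV[R]_n C -> C 0 ->
  (forall k w, 0 <= k -> C w -> C (k *: w)) -> polar (polar C) = C.
Proof.
move=> clC /convex_setP cC C0 coneC.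
apply/seteqP; split=> [w PPw | w Cw v Pv]; last by rewrite dotC; exact: Pv.
have [|p Cp pmin] := @nearest_point C w clC; first by exists 0.
have proj c : C c -> dot (w - p) (c - p) <= 0.
  move=> Cc; suff : 0 <= - 2 * dot (w - p) (c - p) by lra.
  apply: (@quadratic_ge0_at_zero _ _ (dot (c - p) (c - p)) 0 1) => // h.
  move=> /andP[h0 h1].
  have /pmin : C (h *: c + (1 - h) *: p) by apply: cC => //; rewrite ltW.
  have -> : w - (h *: c + (1 - h) *: p) = (w - p) - h *: (c - p).
    by rewrite scalerBl scale1r scalerBr addrCA opprD addrA.
  rewrite (dot_subsub (w - p)) dotZr dotZl dotZr => H.
  rewrite -(pmulr_rge0 _ h0); lra.
have normal_p : dot (w - p) p = 0.
  apply/eqP; rewrite eq_le; apply/andP; split.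
    have := proj (2 *: p); rewrite scaler_nat mulr2n addrK; apply.
    by rewrite -mulr2n -scaler_nat; exact: coneC.
  by have := proj 0 C0; rewrite sub0r dotNr oppr_le0.
have Ppol : polar C (w - p).
  by move=> c Cc; have := proj c Cc; rewrite dotDr dotNr normal_p subr0.
have := PPw _ Ppol; rewrite -{1}(subrK p w) dotDl (dotC p) normal_p addr0 => H.
suff /eqP : `|w - p| = 0 by rewrite normr_eq0 subr_eq0 => /eqP ->.
apply/eqP; rewrite eq_le normr_ge0 andbT; apply: norm_le_of_dot => //.
by rewrite expr0n.
Qed.

End ConvexDuality.

(** * Duality between the directional cones *)

Section DirectionalDuality.
Context {R : realType} {n : nat}.
Implicit Types (S : set 'rV[R]_n) (x d u v w : 'rV[R]_n).

Lemma regular_normalZ S x (k : R) w : 0 <= k ->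
  regular_normal_cone S x w -> regular_normal_cone S x (k *: w).
Proof.
move=> k0 [Sx Nw]; split=> // e e0.
have k1 : 0 < k + 1 by lra.
have := Nw (e / (k + 1)) (divr_gt0 e0 k1); rewrite !near_withinE.
apply: filterS => y le_y Sy.
rewrite dotZl; apply: le_trans (ler_wpM2l k0 (le_y Sy)) _.
rewrite mulrA ler_wpM2r ?enorm_ge0 // mulrCA ler_piMr ?(ltW e0) //.
by rewrite ler_pdivrMr // mul1r; lra.
Qed.

Lemma regular_normal0 S x : S x -> regular_normal_cone S x 0.
Proof.
move=> Sx; split=> // e e0; rewrite near_withinE; apply: nearW => y _.
by rewrite dot0l mulr_ge0 ?enorm_ge0 // ltW.
Qed.

Lemma regular_normal_tangent S x w u :
  regular_normal_cone S x w -> tangent_cone S x u -> dot w u <= 0.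
Proof.
move=> [Sx Nw] [t [u_ [[t0 tcv] ucv Su]]].
have pcv : x + t k *: u_ k @[k --> \oo] --> x.
  have : x + t k *: u_ k @[k --> \oo] --> x + 0 *: u.
    by apply: cvgD; [exact: cvg_cst|exact: cvgZ].
  by rewrite scale0r addr0.
have bound e : 0 < e -> dot w u <= e * enorm u.
  move=> e0; rewrite -subr_ge0.
  have lim_diff : e * enorm (u_ k) - dot w (u_ k) @[k --> \oo]
      --> e * enorm u - dot w u.
    have Nu : enorm (u_ k) @[k --> \oo] --> enorm u by exact: cvg_enorm.
    have Du : dot w (u_ k) @[k --> \oo] --> dot w u.
      by apply: (@cvg_dot _ _ _ _ _ (cst w)) => //; exact: cvg_cst.
    exact: (cvgB (cvgM (cvg_cst e) Nu) Du).
  apply: (closed_cvg (fun r : R => 0 <= r)) lim_diff; first exact: closed_ge.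
  have near_x : \forall y \near x, S y -> dot w (y - x) <= e * enorm (y - x).
    by have := Nw e e0; rewrite near_withinE.
  have near_oo : \forall k \near \oo,
      dot w (x + t k *: u_ k - x) <= e * enorm (x + t k *: u_ k - x).
    have [N _ HN] := pcv _ near_x; exists N => // k Nk; exact: HN.
  apply: filterS near_oo => k.
  rewrite addrAC subrr add0r dotZr enormZ ?(ltW (t0 k)) //.
  rewrite mulrCA ler_pM2l ?t0 //.
  by rewrite subr_ge0.
rewrite -[leRHS]add0r; apply/ler_addgt0Pr => e e0; rewrite !add0r.
have N1 : 0 < enorm u + 1 by have := enorm_ge0 u; lra.
apply: le_trans (bound (e / (enorm u + 1)) (divr_gt0 e0 N1)) _.
rewrite mulrAC -mulrA ler_piMr ?(ltW e0) // ler_pdivrMr // mul1r; lra.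
Qed.

Lemma dir_normalZ S x d (k : R) w : 0 <= k ->
  dir_normal_cone S x d w -> dir_normal_cone S x d (k *: w).
Proof.
move=> k0 [t [d_ [w_ [t0 dcv wcv Nw]]]]; exists t, d_, (fun i => k *: w_ i).
split=> // [|i]; last exact: regular_normalZ.
by apply: cvgZ => //; exact: cvg_cst.
Qed.

Lemma dir_normal0 S x d : tangent_cone S x d -> dir_normal_cone S x d 0.
Proof.
move=> [t [d_ [t0 dcv Sd]]]; exists t, d_, (fun=> 0); split=> // [|k].
  exact: cvg_cst.
exact: regular_normal0.
Qed.

(** If this fails, there are points p of S, reached from x at small times in
    directions close to d, with no tangent within e of v.  The lemma
    [sliding_ball] moves each of them by a negligible amount to a point that has
    a normal w in the unit ball with <w, v> >= e / 2.  These conditions on w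
    define a compact set, so a limit w remains in it; this w is a directional
    normal, contrary to <w, v> <= 0. *)
Lemma tangent_uniform_of_polar_normal S x d v (e : R) : closed S ->
  polar (dir_normal_cone S x d) v -> 0 < e ->
  exists r, 0 < r /\ forall t d', 0 < t < r -> `|d' - d| < r ->
    S (x + t *: d') ->
    exists u, tangent_cone S (x + t *: d') u /\ `|u - v| <= e.
Proof.
move=> cS Pv e0; apply: contrapT => nr.
have bad r : 0 < r -> exists t d', [/\ 0 < t < r, `|d' - d| < r,
    S (x + t *: d')
  & forall u, tangent_cone S (x + t *: d') u -> ~ `|u - v| <= e].
  move=> r0; apply: contrapT => H; apply: nr; exists r; split=> //.
  move=> t d' tr dr Sp; apply: contrapT => nu; apply: H; exists t, d'.
  by split=> // u Tu uv; apply: nu; exists u.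
pose A r w := exists t d', [/\ 0 < t < r, `|d' - d| < r
  & regular_normal_cone S (x + t *: d') w].
pose c := e / 2.
have c0 : 0 < c by rewrite /c; lra.
pose K : set 'rV[R]_n := [set w | c <= dot w v] `&` [set w | `|w - 0| <= 1].
have cK : compact K by apply: compact_norm_le; exact: closed_dot_ge.
have [||w [[cw _] Aw]] := @compact_approx _ _ K A cK.
- move=> r s w rs [t [d' [/andP[t0 tr] dr Nw]]]; exists t, d'; split=> //.
    by rewrite t0 (lt_le_trans tr).
  exact: lt_le_trans dr rs.
- move=> r r0; pose r2 := r / 2; have r20 : 0 < r2 by rewrite /r2; lra.
  have [t [d' [/andP[t0 tr] dr Sp far]]] := bad r2 r20.
  set p := x + t *: d' in Sp far.
  (* a step h so short that S stays e * h away from p + h *: v, and that the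
     foot point found below moves the direction by less than r / 2 *)
  have [h [/andP[h0 hr] hfar]] : exists h, 0 < h < t * r2 / (2 * e + `|v|) /\
      forall z, S z -> e * h < `|p + h *: v - z|.
    apply: contrapT => nh.
    have [s s0|u [Tu uv]] := @tangent_cone_near _ _ S p v e; last first.
      exact: far Tu uv.
    apply: contrapT => ns; apply: nh.
    have v0 := normr_ge0 v.
    have b0 : 0 < t * r2 / (2 * e + `|v|).
      by apply: divr_gt0; [exact: mulr_gt0|lra].
    pose m := Num.min s (t * r2 / (2 * e + `|v|)).
    have m0 : 0 < m by rewrite lt_min s0.
    have ms : m <= s by rewrite ge_min lexx.
    have mb : m <= t * r2 / (2 * e + `|v|) by rewrite ge_min lexx orbT.
    pose h := m / 2.
    have h0 : 0 < h by rewrite /h; lra.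
    exists h; split; first by rewrite h0 /= /h; lra.
    move=> z Sz; rewrite ltNge; apply/negP => le_z; apply: ns.
    by exists h, z; split=> //; rewrite h0 /= /h; lra.
  have v0 := normr_ge0 v.
  have ev0 : 0 < 2 * e + `|v| by lra.
  have [z Sz|y [w [Nw w1 cw yp]]] := @sliding_ball _ _ S p v h c cS Sp h0 c0.
    have ->: 2 * c = e by rewrite /c; field.
    rewrite -sqr_enorm ltrXn2r //; first by nra.
    exact: lt_le_trans (hfar z Sz) (norm_le_enorm _).
  exists w; split; first by split=> //=; rewrite subr0.
  exists t, (t^-1 *: (y - x)); split.
  + by rewrite t0 /=; rewrite /r2 in tr; lra.
  + have -> : t^-1 *: (y - x) - d = t^-1 *: (y - p) + (d' - d).
      rewrite /p opprD (addrA y) (scalerBr _ (y - x)) scalerA.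
      rewrite mulVf ?gt_eqF // scale1r.
      by rewrite addrA subrK.
    apply: le_lt_trans (ler_normD _ _) _.
    rewrite normrZ gtr0_norm ?invr_gt0 //.
    have : t^-1 * `|y - p| <= r2.
      rewrite mulrC ler_pdivrMr // mulrC; apply: le_trans yp _.
      rewrite ltr_pdivlMr // in hr.
      have -> : 2 * c = e by rewrite /c; field.
      nra.
    by rewrite /r2 in dr *; lra.
  + by rewrite scalerA divff ?gt_eqF // scale1r addrC subrK.
have Nw : dir_normal_cone S x d w.
  apply: dir_normal_cone_approx => r r0.
  have [w' [[t [d' [tr dr Nw']]] ww']] := Aw r r0.
  by exists t, d', w'.
have := Pv w Nw; rewrite dotC => H.
by have := lt_le_trans c0 (le_trans cw H); rewrite ltxx.
Qed.

(** A selection principle: the tangent vectors converging to v have to be chosen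
    independently of the accuracy e, so each of them is almost optimal. *)
Lemma almost_nearest (A : set 'rV[R]_n) v (e : R) : A !=set0 -> 0 < e ->
  exists2 u, A u & forall u', A u' -> `|u - v| <= `|u' - v| + e.
Proof.
move=> [a Aa] e0; pose D := (fun u => `|u - v|) @` A.
have hD : has_inf D.
  by split; [exists `|a - v|, a|exists 0 => _ [u _ <-]].
have [_ [u Au <-] uD] := inf_adherent e0 hD.
exists u => // u' Au'; apply: le_trans (ltW uD) _; rewrite lerD2r.
by apply: ge_inf; [exact: hD.2|exists u'].
Qed.

Lemma dir_regular_tangent_coneE S x d : closed S ->
  dir_regular_tangent_cone S x d = polar (dir_normal_cone S x d).
Proof.
move=> cS; apply/seteqP; split=> [v Tv w | v Pv t d_ t0 dcv Sp].
  move=> [t [d_ [w_ [t0 dcv wcv Nw]]]].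
  have [v_ [vcv Tv_]] := Tv t d_ t0 dcv (fun k => (Nw k).1).
  have lim_dot : dot (v_ k) (w_ k) @[k --> \oo] --> dot v w by exact: cvg_dot.
  apply: (closed_cvg (fun r : R => r <= 0)) lim_dot; first exact: closed_le.
  apply: nearW => k; rewrite dotC; exact: regular_normal_tangent (Nw k) (Tv_ k).
have /choice[v_ v_P] : forall k, exists u, tangent_cone S (x + t k *: d_ k) u /\
    forall u', tangent_cone S (x + t k *: d_ k) u' ->
      `|u - v| <= `|u' - v| + k.+1%:R^-1.
  move=> k; have [||u Tu umin] :=
    @almost_nearest (tangent_cone S (x + t k *: d_ k)) v k.+1%:R^-1.
  - by exists 0; exact: tangent_cone0.
  - by rewrite invr_gt0.
  - by exists u.
exists v_; split=> [|k]; last by have [] := v_P k.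
apply/cvgrPdist_lt => e e0.
have e20 : 0 < e / 2 by lra.
have [r [r0 near_v]] := tangent_uniform_of_polar_normal cS Pv e20.
near=> k; rewrite distrC.
have [|||u [Tu uv]] := near_v (t k) (d_ k); last first.
- have k_small : k.+1%:R^-1 < e / 2.
    near: k; exact: (near_infty_natSinv_lt (PosNum e20)).
  apply: le_lt_trans ((v_P k).2 u Tu) _.
  by rewrite [ltRHS]splitr ler_ltD.
- exact: Sp.
- near: k; move/cvgrPdist_lt: dcv => /(_ r r0).
  by apply: filterS => k; rewrite distrC.
- rewrite t0.1 /=; near: k; exact: (cvgr_lt _ t0.2).
Unshelve. all: end_near. Qed.

End DirectionalDuality.

(** * The polarity theorem *)

(* If d is not tangent, the normal cones are empty and the tangent cone is the
   whole space, whose polar is {0}: hence the condition on the last equality. *)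
Theorem proposition3 (R : realType) (n : nat) (S : set 'rV[R]_n)
    (x d : 'rV[R]_n) (hS : closed S) (hx : S x) :
  [/\ dir_regular_tangent_cone S x d = polar (dir_normal_cone S x d),
      polar (dir_normal_cone S x d) = polar (dir_clarke_normal_cone S x d),
      (tangent_cone S x d ->
       polar (dir_regular_tangent_cone S x d) = dir_clarke_normal_cone S x d),
      closed (dir_regular_tangent_cone S x d)
    & @convex_set R 'rV[R]_n (dir_regular_tangent_cone S x d)].
Proof.
rewrite dir_regular_tangent_coneE //.
split=> // [|Td||]; last 2 first.
- exact: closed_polar.
- exact: convex_polar.
- by rewrite /dir_clarke_normal_cone polar_closed_convex_hull.
rewrite -(polar_closed_convex_hull (dir_normal_cone S x d)); apply: bipolar.
- exact: closed_closure.
- exact/convex_closure/convex_convex_hull.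
- exact/sub_closed_convex_hull/dir_normal0.
- by apply: closed_convex_hull_cone => k w; exact: dir_normalZ.
Qed.
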